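(* (i) For $\omega\in\mathbb{B}$, the series $\sum_{n=1}^{\infty}\frac{1}{n^{\omega}}$ is absolutely convergent (i.e. $\sum_{n\ge1}\|n^{-\omega}\|_{\mathbf{j}}<\infty$) if and only if $\omega\in U$. Moreover, for $\omega\in U$, $$\Big\|\sum_{n=1}^{\infty}\frac{1}{n^{\omega}}\Big\|_{\mathbf{j}}\le\zeta\big(i_{\mathbb{R}}(\omega)\big),$$ where on the right $\zeta$ is the classical Riemann zeta function. (ii) The series $\sum_{n=1}^{\infty}\frac{1}{n^{\omega}}$ is uniformly convergent on each compact subset of $U$.
   Context: $\mathbb{B}$ is the commutative real algebra of bicomplex numbers $a+b\mathbf{i}+c\mathbf{j}+d\mathbf{k}$ ($a,b,c,d\in\mathbb{R}$), with $\mathbf{i}^2=\mathbf{k}^2=-1$, $\mathbf{j}^2=1$, $\mathbf{i}\mathbf{k}=\mathbf{k}\mathbf{i}=\mathbf{j}$. Put $\mathbf{e}_1=\frac{1+\mathbf{j}}{2}$, $\mathbf{e}_2=\frac{1-\mathbf{j}}{2}$, and identify $\mathbb{C}$ with $\{x+\mathbf{i}y\}\subset\mathbb{B}$. Every $\omega\in\mathbb{B}$ is uniquely $\omega=\mathcal{P}_1(\omega)\mathbf{e}_1+\mathcal{P}_2(\omega)\mathbf{e}_2$ with $\mathcal{P}_k(\omega)\in\mathbb{C}$. The norm $\|\cdot\|_{\mathbf{j}}$ on $\mathbb{B}$ is the Riesz subnorm of the hyperbolic-valued $\mathbf{j}$-modulus $|\omega|_{\mathbf{j}}=|\mathcal{P}_1(\omega)|\mathbf{e}_1+|\mathcal{P}_2(\omega)|\mathbf{e}_2$;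 explicitly $\|\omega\|_{\mathbf{j}}=\max\{|\mathcal{P}_1(\omega)|,|\mathcal{P}_2(\omega)|\}$. $e^\omega=\sum_{n\ge0}\omega^n/n!$, and for an integer $n\ge1$, $n^{\omega}=e^{\omega\ln n}$. $i_{\mathbb{R}}(\omega)=\min\{\mathrm{Re}\,\mathcal{P}_1(\omega),\mathrm{Re}\,\mathcal{P}_2(\omega)\}\in\mathbb{R}$ (equivalently $\mathrm{Re}_{\mathbf{j}}(\omega)\wedge\overline{\mathrm{Re}_{\mathbf{j}}(\omega)}$ in the lattice of hyperbolic numbers). $U=\{\omega\in\mathbb{B}:i_{\mathbb{R}}(\omega)>1\}$, i.e. the set of $\omega$ with $\mathrm{Re}\,\mathcal{P}_1(\omega)>1$ and $\mathrm{Re}\,\mathcal{P}_2(\omega)>1$. *)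

(* Defs.v *)
From HB Require Import structures.
From mathcomp Require Import all_boot all_order all_algebra.
From mathcomp Require Import complex ring lra.
From mathcomp Require Import all_classical all_reals all_analysis.

Set Implicit Arguments.
Unset Strict Implicit.
Unset Printing Implicit Defensive.

Import Order.TTheory GRing.Theory Num.Theory.
Import numFieldNormedType.Exports.
Import Normc.

Local Open Scope classical_set_scope.
Local Open Scope ring_scope.

(* [Bicomplex a b c d] stands for a + b i + c j + d k. *)
Record bicomplex (R : realType) := Bicomplex {
  bc1 : R ; bci : R ; bcj : R ; bck : R }.

Section Algebra.
Variable R : realType.
Local Notation B := (bicomplex R).
Local Notation C := (complex R).
Implicit Types (x y z w : B) (t : R) (u v : C).

Definition bc_to_prod w : R * R * R * R := (bc1 w, bci w, bcj w, bck w).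
Definition bc_of_prod (p : R * R * R * R) : B :=
  Bicomplex p.1.1.1 p.1.1.2 p.1.2 p.2.

Fact bc_to_prodK : cancel bc_to_prod bc_of_prod.
Proof. by case. Qed.

HB.instance Definition _ := Choice.copy B (can_type bc_to_prodK).

Fact bcP x y : bc1 x = bc1 y -> bci x = bci y -> bcj x = bcj y ->
  bck x = bck y -> x = y.
Proof. by case: x => a b c d; case: y => a' b' c' d' /= -> -> -> ->. Qed.

Definition bc_zero : B := Bicomplex 0 0 0 0.
Definition bc_one : B := Bicomplex 1 0 0 0.
Definition bc_opp w : B := Bicomplex (- bc1 w) (- bci w) (- bcj w) (- bck w).
Definition bc_add x y : B :=
  Bicomplex (bc1 x + bc1 y) (bci x + bci y) (bcj x + bcj y) (bck x + bck y).
(* i^2 = k^2 = -1, j^2 = 1, i k = j; hence i j = - k and j k = - i. *)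
Definition bc_mul x y : B := Bicomplex
  (bc1 x * bc1 y - bci x * bci y + bcj x * bcj y - bck x * bck y)
  (bc1 x * bci y + bci x * bc1 y - bcj x * bck y - bck x * bcj y)
  (bc1 x * bcj y + bcj x * bc1 y + bci x * bck y + bck x * bci y)
  (bc1 x * bck y + bck x * bc1 y - bci x * bcj y - bcj x * bci y).
Definition bc_scale t w : B :=
  Bicomplex (t * bc1 w) (t * bci w) (t * bcj w) (t * bck w).

Fact bc_addA : associative bc_add.
Proof. by move=> x y z; apply: bcP => /=; ring. Qed.
Fact bc_addC : commutative bc_add.
Proof. by move=> x y; apply: bcP => /=; ring. Qed.
Fact bc_add0 : left_id bc_zero bc_add.
Proof. by move=> x; apply: bcP => /=; ring. Qed.
Fact bc_addN : left_inverse bc_zero bc_opp bc_add.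
Proof. by move=> x; apply: bcP => /=; ring. Qed.

HB.instance Definition _ :=
  GRing.isZmodule.Build B bc_addA bc_addC bc_add0 bc_addN.

Fact bc_mulA : associative bc_mul.
Proof. by move=> x y z; apply: bcP => /=; ring. Qed.
Fact bc_mulC : commutative bc_mul.
Proof. by move=> x y; apply: bcP => /=; ring. Qed.
Fact bc_mul1 : left_id bc_one bc_mul.
Proof. by move=> x; apply: bcP => /=; ring. Qed.
Fact bc_mulD : left_distributive bc_mul +%R.
Proof. by move=> x y z; apply: bcP => /=; ring. Qed.
Fact bc_one_neq0 : bc_one != 0.
Proof. by apply/eqP => -[] /eqP; rewrite oner_eq0. Qed.

HB.instance Definition _ := GRing.Zmodule_isComNzRing.Build B
  bc_mulA bc_mulC bc_mul1 bc_mulD bc_one_neq0.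

Fact bc_scaleA s t w : bc_scale s (bc_scale t w) = bc_scale (s * t) w.
Proof. by apply: bcP => /=; ring. Qed.
Fact bc_scale1 : left_id 1 bc_scale.
Proof. by move=> x; apply: bcP => /=; ring. Qed.
Fact bc_scaleDr : right_distributive bc_scale +%R.
Proof. by move=> t x y; apply: bcP => /=; ring. Qed.
Fact bc_scaleDl w : {morph bc_scale^~ w : s t / s + t}.
Proof. by move=> s t; apply: bcP => /=; ring. Qed.

HB.instance Definition _ := GRing.Zmodule_isLmodule.Build R B
  bc_scaleA bc_scale1 bc_scaleDr bc_scaleDl.

Fact bc_scaleAl t x y : t *: (x * y) = t *: x * y.
Proof. by apply: bcP => /=; ring. Qed.

HB.instance Definition _ := GRing.Lmodule_isLalgebra.Build R B bc_scaleAl.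
HB.instance Definition _ := GRing.Lalgebra_isComAlgebra.Build R B.

Definition bc_i : B := Bicomplex 0 1 0 0.
Definition bc_j : B := Bicomplex 0 0 1 0.
Definition bc_k : B := Bicomplex 0 0 0 1.

Definition bc_e1 : B := 2^-1 *: (1 + bc_j).
Definition bc_e2 : B := 2^-1 *: (1 - bc_j).

Definition bc_of_complex u : B := Bicomplex (complex.Re u) (complex.Im u) 0 0.

(* As e1 j = e1, e2 j = - e2 and k = - i j, the component on e1 is obtained by
   j := 1, k := - i, and the one on e2 by j := -1, k := i. *)
Definition bc_P1 w : C := Complex (bc1 w + bcj w) (bci w - bck w).
Definition bc_P2 w : C := Complex (bc1 w - bcj w) (bci w + bck w).

Fact bc_idempotentE w :
  w = bc_of_complex (bc_P1 w) * bc_e1 + bc_of_complex (bc_P2 w) * bc_e2.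
Proof. by apply: bcP => /=; field. Qed.

Fact bc_idempotent_uniq w u v :
  w = bc_of_complex u * bc_e1 + bc_of_complex v * bc_e2 ->
  u = bc_P1 w /\ v = bc_P2 w.
Proof.
by case: u => a b; case: v => c d ->; split; apply/eqP;
  rewrite eq_complex /=; apply/andP; split; apply/eqP; field.
Qed.

Fact bc_P1M x y : bc_P1 (x * y) = bc_P1 x * bc_P1 y.
Proof.
by apply/eqP; rewrite eq_complex /=; apply/andP; split; apply/eqP; ring.
Qed.

Fact bc_P2M x y : bc_P2 (x * y) = bc_P2 x * bc_P2 y.
Proof.
by apply/eqP; rewrite eq_complex /=; apply/andP; split; apply/eqP; ring.
Qed.

Fact bc_P_inj x y : bc_P1 x = bc_P1 y -> bc_P2 x = bc_P2 y -> x = y.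
Proof. by move=> h1 h2; rewrite (bc_idempotentE x) h1 h2 -bc_idempotentE. Qed.

Definition bc_unit : pred B := fun w => (bc_P1 w != 0) && (bc_P2 w != 0).
Definition bc_inv w : B :=
  if bc_unit w then bc_of_complex (bc_P1 w)^-1 * bc_e1
                    + bc_of_complex (bc_P2 w)^-1 * bc_e2
  else w.

Fact bc_mulV : {in bc_unit, left_inverse 1 bc_inv *%R}.
Proof.
move=> w hw; rewrite /bc_inv ifT //.
set x := (_ + _ : B); have [hx1 hx2] := bc_idempotent_uniq (erefl x).
have /andP [n1 n2] : bc_unit w by [].
by apply: bc_P_inj; rewrite (bc_P1M, bc_P2M) -(hx1, hx2) mulVf //;
  apply/eqP; rewrite eq_complex /= !(addr0, subr0, subrr) !eqxx.
Qed.

Fact bc_unitPl x y : y * x = 1 -> bc_unit x.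
Proof.
move=> h; apply/andP; split; apply/eqP => h0.
- have := bc_P1M y x; rewrite h h0 mulr0 => -[] /eqP.
  by rewrite addr0 oner_eq0.
- have := bc_P2M y x; rewrite h h0 mulr0 => -[] /eqP.
  by rewrite subr0 oner_eq0.
Qed.

Fact bc_inv_out : {in [predC bc_unit], bc_inv =1 id}.
Proof.
by move=> w; rewrite unfold_in /= => /negPf hw; rewrite /bc_inv ifF.
Qed.

HB.instance Definition _ := GRing.ComNzRing_hasMulInverse.Build B
  bc_mulV bc_unitPl bc_inv_out.

(* The norm underlying the topology and uniformity of the bicomplex numbers. *)
Definition bc_norm w : R :=
  Num.max (normc (bc_P1 w)) (normc (bc_P2 w)).

Fact bc_P1D x y : bc_P1 (x + y) = bc_P1 x + bc_P1 y.
Proof.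
by apply/eqP; rewrite eq_complex /=; apply/andP; split; apply/eqP; ring.
Qed.

Fact bc_P2D x y : bc_P2 (x + y) = bc_P2 x + bc_P2 y.
Proof.
by apply/eqP; rewrite eq_complex /=; apply/andP; split; apply/eqP; ring.
Qed.

Fact bc_ler_normD x y : bc_norm (x + y) <= bc_norm x + bc_norm y.
Proof.
rewrite /bc_norm bc_P1D bc_P2D ge_max; apply/andP; split.
- by apply: (le_trans (le_normcD _ _)); apply: lerD; rewrite le_max lexx.
- by apply: (le_trans (le_normcD _ _)); apply: lerD;
    rewrite le_max lexx orbT.
Qed.

Fact bc_normZ t w : bc_norm (t *: w) = `|t| * bc_norm w.
Proof.
have sq (a b : R) : Num.sqrt ((t * a) ^+ 2 + (t * b) ^+ 2)
    = `|t| * Num.sqrt (a ^+ 2 + b ^+ 2).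
  by rewrite !exprMn -mulrDr sqrtrM ?sqr_ge0// sqrtr_sqr.
rewrite /bc_norm /normc /= -!mulrDr -!mulrBr !sq.
by rewrite maxr_pMr.
Qed.

Fact bc_norm0_eq0 w : bc_norm w = 0 -> w = 0.
Proof.
move=> h.
have h1 : normc (bc_P1 w) = 0.
  apply/eqP; rewrite eq_le -{1}h le_max lexx /=.
  by case: (bc_P1 w) => a b /=; exact: sqrtr_ge0.
have h2 : normc (bc_P2 w) = 0.
  apply/eqP; rewrite eq_le -{1}h le_max lexx orbT /=.
  by case: (bc_P2 w) => a b /=; exact: sqrtr_ge0.
apply: bc_P_inj; rewrite (eq0_normc h1, eq0_normc h2);
  by apply/eqP; rewrite eq_complex /= !(addr0, subr0) !eqxx.
Qed.

HB.instance Definition _ := Lmodule_isNormed.Build R B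
  bc_ler_normD bc_normZ bc_norm0_eq0.

Definition bc_exp w : B := limn (series (fun n => n`!%:R^-1 *: w ^+ n)).

(* n^w = e^(w ln n), meaningful for n >= 1. *)
Definition bc_npow n w : B := bc_exp (ln n%:R *: w).

Definition bc_iR w : R := Num.min (complex.Re (bc_P1 w)) (complex.Re (bc_P2 w)).

Definition bc_U : set B := [set w | 1 < bc_iR w].

(* The index is shifted: the term of index n is 1 / (n + 1)^w. The division is
   the one of the ring; exponentials are units, so it is never degenerate. *)
Definition bc_zeta_term w : B ^nat := fun n => 1 / bc_npow n.+1 w.

Definition bc_zeta w : B := limn (series (bc_zeta_term w)).

End Algebra.

(* The Riemann zeta function at a real s > 1, given there by its Dirichlet
   series; no meaning is attached to the values at s <= 1. *)
Definition riemann_zeta (R : realType) (s : R) : R :=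
  limn (series (fun n => n.+1%:R `^ (- s))).

(* Main.v *)
(* In the idempotent components, [|e^(t w)|] is [e^(t Re P_k(w))]: writing
   [f + i g] for the component of the exponential series, [f' = x f - y g] and
   [g' = y f + x g], whence [(f^2 + g^2) e^(- 2 x t)] is constant. So
   [|n^(- w)|] is exactly [n^(- i_R(w))], which reduces absolute convergence and
   the bound on the sum to the real series of [n^(- s)]. On a compact subset of
   [U] the continuous function [i_R] attains a minimum [s0 > 1], and the
   Weierstrass M-test applies with majorants [n^(- s0)]. *)
Require Import Defs.
From HB Require Import structures.
From mathcomp Require Import all_boot all_order all_algebra.
From mathcomp Require Import complex ring lra.
From mathcomp Require Import all_classical all_reals all_analysis.
Import Order.TTheory GRing.Theory Num.Theory.
Import numFieldNormedType.Exports.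
Import Normc.
Local Open Scope classical_set_scope.
Local Open Scope ring_scope.

(** * Complex modulus against real and imaginary parts *)

Lemma normr_Re_le (R : realType) (z : R[i]) : `|complex.Re z| <= normc z.
Proof.
by case: z => a b /=; rewrite -sqrtr_sqr ler_wsqrtr// lerDl sqr_ge0.
Qed.

Lemma normr_Im_le (R : realType) (z : R[i]) : `|complex.Im z| <= normc z.
Proof.
by case: z => a b /=; rewrite -sqrtr_sqr ler_wsqrtr// lerDr sqr_ge0.
Qed.

Lemma normc_le_ReIm (R : realType) (z : R[i]) :
  normc z <= `|complex.Re z| + `|complex.Im z|.
Proof.
case: z => a b /=; rewrite -[leRHS]ger0_norm ?addr_ge0// -sqrtr_sqr.
rewrite ler_wsqrtr// sqrrD !real_normK ?num_real//.
by rewrite lerD2r lerDl mulrn_wge0 ?mulr_ge0.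
Qed.

Lemma complex_ReB (R : realType) (z z' : R[i]) :
  complex.Re (z - z') = complex.Re z - complex.Re z'.
Proof. by case: z; case: z'. Qed.

Lemma complex_ImB (R : realType) (z z' : R[i]) :
  complex.Im (z - z') = complex.Im z - complex.Im z'.
Proof. by case: z; case: z'. Qed.

(** The image of a Cauchy filter under a 1-Lipschitz map is Cauchy, and the real line is complete.
    It serves for the four real coordinates of a bicomplex number. *)
Lemma cauchy_contraction (R : realType) (V : normedModType R)
    (F : set_system V) (FF : ProperFilter F) (p : V -> R) :
  (forall x y, `|p x - p y| <= `|x - y|) -> cauchy F -> cvg (p @ F).
Proof.
move=> pB /cauchy_ballP Fc; apply/cauchy_cvgP/cauchy_ballP => e e0.
have := Fc e e0; rewrite !near_simpl /=.
move=> [[P Q] /= [FP FQ] PQ]; exists (p @` P, p @` Q) => /=.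
  by split; [apply: filterS FP | apply: filterS FQ] => x ?; exists x.
move=> [_ _] /= [[x Px <-] [y Qy <-]].
have := PQ (x, y) (conj Px Qy); rewrite -!ball_normE /ball_ /=.
by apply: le_lt_trans.
Qed.

(** * Bicomplex norm, idempotent coordinates and completeness *)

Section bicomplex_norm.
Variable R : realType.
Local Notation B := (bicomplex R).
Implicit Types w : B.

Lemma bc_normE w : `|w| = Num.max (normc (bc_P1 w)) (normc (bc_P2 w)).
Proof. by []. Qed.

Lemma normc_P1_le w : normc (bc_P1 w) <= `|w|.
Proof. by rewrite bc_normE le_max lexx. Qed.

Lemma normc_P2_le w : normc (bc_P2 w) <= `|w|.
Proof. by rewrite bc_normE le_max lexx orbT. Qed.

Lemma bc_norm_le_coord w :
  `|w| <= `|complex.Re (bc_P1 w)| + `|complex.Im (bc_P1 w)|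
        + `|complex.Re (bc_P2 w)| + `|complex.Im (bc_P2 w)|.
Proof.
rewrite bc_normE ge_max -addrA; apply/andP; split.
- by apply: (le_trans (normc_le_ReIm _ _)); rewrite lerDl addr_ge0.
- by apply: (le_trans (normc_le_ReIm _ _)); rewrite lerDr addr_ge0.
Qed.

Lemma bc_P1B x y : bc_P1 (x - y : B) = bc_P1 x - bc_P1 y.
Proof.
by apply/eqP; rewrite eq_complex /=; apply/andP; split; apply/eqP; ring.
Qed.

Lemma bc_P2B x y : bc_P2 (x - y : B) = bc_P2 x - bc_P2 y.
Proof.
by apply/eqP; rewrite eq_complex /=; apply/andP; split; apply/eqP; ring.
Qed.

Lemma bc_cvg (T : Type) (F : set_system T) (FF : Filter F)
    (u : T -> B) (l : B) :
  complex.Re (bc_P1 (u x)) @[x --> F] --> complex.Re (bc_P1 l) ->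
  complex.Im (bc_P1 (u x)) @[x --> F] --> complex.Im (bc_P1 l) ->
  complex.Re (bc_P2 (u x)) @[x --> F] --> complex.Re (bc_P2 l) ->
  complex.Im (bc_P2 (u x)) @[x --> F] --> complex.Im (bc_P2 l) ->
  u @ F --> l.
Proof.
move=> h1 h2 h3 h4; apply/cvgrPdist_lt => e e0.
have e40 : 0 < e / 4 by rewrite divr_gt0.
near=> x; apply: le_lt_trans (bc_norm_le_coord _) _.
rewrite bc_P1B bc_P2B.
have -> : e = e / 4 + e / 4 + e / 4 + e / 4 by field.
apply: ltrD; first apply: ltrD; first apply: ltrD; near: x.
- by move/cvgrPdist_lt : h1 => /(_ _ e40);
    apply: filterS => x; rewrite complex_ReB.
- by move/cvgrPdist_lt : h2 => /(_ _ e40);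
    apply: filterS => x; rewrite complex_ImB.
- by move/cvgrPdist_lt : h3 => /(_ _ e40);
    apply: filterS => x; rewrite complex_ReB.
- by move/cvgrPdist_lt : h4 => /(_ _ e40);
    apply: filterS => x; rewrite complex_ImB.
Unshelve. all: by end_near. Qed.

Definition bc_of_proj (z1 z2 : R[i]) : B :=
  bc_of_complex z1 * @bc_e1 R + bc_of_complex z2 * @bc_e2 R.

Lemma bc_P1_of_proj z1 z2 : bc_P1 (bc_of_proj z1 z2) = z1.
Proof. by have [<-] := bc_idempotent_uniq (erefl (bc_of_proj z1 z2)). Qed.

Lemma bc_P2_of_proj z1 z2 : bc_P2 (bc_of_proj z1 z2) = z2.
Proof. by have [_ <-] := bc_idempotent_uniq (erefl (bc_of_proj z1 z2)). Qed.

(** The real and imaginary parts of both idempotent components are 1-Lipschitz, so they converge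
    along a Cauchy filter; their limits are then reassembled. *)
Lemma bc_complete (F : set_system B) : ProperFilter F -> cauchy F -> cvg F.
Proof.
move=> FF Fc.
have P1r (x y : B) : `|complex.Re (bc_P1 x) - complex.Re (bc_P1 y)| <= `|x - y|.
  by rewrite -complex_ReB -bc_P1B (le_trans (normr_Re_le _ _)) ?normc_P1_le.
have P1i (x y : B) : `|complex.Im (bc_P1 x) - complex.Im (bc_P1 y)| <= `|x - y|.
  by rewrite -complex_ImB -bc_P1B (le_trans (normr_Im_le _ _)) ?normc_P1_le.
have P2r (x y : B) : `|complex.Re (bc_P2 x) - complex.Re (bc_P2 y)| <= `|x - y|.
  by rewrite -complex_ReB -bc_P2B (le_trans (normr_Re_le _ _)) ?normc_P2_le.
have P2i (x y : B) : `|complex.Im (bc_P2 x) - complex.Im (bc_P2 y)| <= `|x - y|.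
  by rewrite -complex_ImB -bc_P2B (le_trans (normr_Im_le _ _)) ?normc_P2_le.
have /cvg_ex[a1 ha1] : cvg ((fun w : B => complex.Re (bc_P1 w)) @ F).
  exact: cauchy_contraction P1r Fc.
have /cvg_ex[b1 hb1] : cvg ((fun w : B => complex.Im (bc_P1 w)) @ F).
  exact: cauchy_contraction P1i Fc.
have /cvg_ex[a2 ha2] : cvg ((fun w : B => complex.Re (bc_P2 w)) @ F).
  exact: cauchy_contraction P2r Fc.
have /cvg_ex[b2 hb2] : cvg ((fun w : B => complex.Im (bc_P2 w)) @ F).
  exact: cauchy_contraction P2i Fc.
apply/cvg_ex; exists (bc_of_proj (Complex a1 b1) (Complex a2 b2)).
by apply: bc_cvg; rewrite ?bc_P1_of_proj ?bc_P2_of_proj.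
Qed.

End bicomplex_norm.

HB.instance Definition _ (R : realType) :=
  Uniform_isComplete.Build (bicomplex R) (@bc_complete R).

(** * Remainder estimate and Weierstrass M-test *)

Lemma series_normr_remainder (R : realType) (V : completeNormedModType R)
    (u : V^nat) (v : R^nat) (n : nat) :
  (forall k, `|u k| <= v k) -> cvgn (series v) ->
  `|limn (series u) - series u n| <= limn (series v) - series v n.
Proof.
move=> uv cv.
have cu : cvgn (series u).
  apply: normed_cvg; apply: series_le_cvg cv => k //=.
  exact: le_trans (uv k).
have h1 : `|series u m - series u n| @[m --> \oo] -->
    `|limn (series u) - series u n|.
  by apply: cvg_norm; apply: cvgB cu (cvg_cst _).
have h2 : series v m - series v n @[m --> \oo] --> limn (series v) - series v n.
  by apply: cvgB cv (cvg_cst _).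
(* For [m >= n] the triangle inequality compares the blocks of terms from [n] to [m]; letting [m]
   tend to infinity gives the claim. *)
apply: ler_cvg_to h1 h2 _; near=> m.
have nm : (n <= m)%N by near: m; exact: nbhs_infty_ge.
rewrite !sub_series_geq//; apply: le_trans (ler_norm_sum _ _ _) _.
exact: ler_sum.
Unshelve. all: by end_near. Qed.

(** The remainder after [n] terms is at most that of [series M], which does not depend on the point
    of [A]. *)
Lemma weierstrass_M_test (R : realType) (T : choiceType)
    (V : completeNormedModType R) (A : set T) (f : T -> V^nat) (M : R^nat) :
  (forall x n, A x -> `|f x n| <= M n) -> cvgn (series M) ->
  {uniform A, (fun n x => series (f x) n) @ \oo -->
    (fun x => limn (series (f x)))}.
Proof.
move=> fM cM P /uniform_nbhs[E [entE EP]].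
move: entE; rewrite -entourage_ballE => -[e /= e0 eE].
move/cvgrPdist_lt : (cM) => /(_ e e0); apply: filterS => n Mn.
apply: EP => /= x Ax; apply: eE; rewrite /= -ball_normE /ball_ /=.
apply: le_lt_trans (series_normr_remainder _ _ _ _ _ (fun k => fM x k Ax) cM) _.
exact: le_lt_trans (ler_norm _) Mn.
Qed.

(** * The real series of n^(-s) *)

Section dirichlet_bound.
Variable R : realType.

(** Discrete form of the integral test: e t^(-(1+e)) is decreasing with primitive -t^(-e), so its
    integral over [n+1, n+2] is at least its value at n+2. The proof replaces the integral by the
    bounds 1 + x <= exp x and ln (1 + x) <= x. *)
Lemma powR_telescope_ge (e : R) (n : nat) : 0 < e ->
  e * n.+2%:R `^ (- (1 + e)) <= n.+1%:R `^ (- e) - n.+2%:R `^ (- e).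
Proof.
move=> e0.
have n1 : 0 < n.+1%:R :> R by rewrite ltr0n.
have n2 : 0 < n.+2%:R :> R by rewrite ltr0n.
(* [ln (1 - 1 / b) <= - 1 / b] with [b = n + 2] *)
have lnb : ln n.+1%:R <= ln n.+2%:R - n.+2%:R^-1 :> R.
  rewrite -lerBlDl -ln_div ?posrE//.
  have -> : n.+1%:R / n.+2%:R = 1 + - n.+2%:R^-1 :> R.
    by apply: (mulIf (lt0r_neq0 n2)); rewrite mulfVK ?gt_eqF// mulrDl
      mul1r mulNr mulVf ?gt_eqF// -[n.+2%:R]natr1 addrK.
  by rewrite le_ln1Dx// ltrN2 invf_lt1// ltr1n.
have -> : n.+2%:R `^ (- (1 + e)) = n.+2%:R `^ (- e) * n.+2%:R^-1 :> R.
  by rewrite opprD addrC powRD ?(gt_eqF n2) ?implybT// powR_inv1// ltW.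
(* With b = n+2: b^(-e) (1 + e/b) <= b^(-e) exp (e/b) <= (n+1)^(-e), the last step being [lnb]
   multiplied by [e]. *)
have : n.+2%:R `^ (- e) * (1 + e * n.+2%:R^-1) <= n.+1%:R `^ (- e) :> R.
  apply: (@le_trans _ _ (n.+2%:R `^ (- e) * expR (e * n.+2%:R^-1))).
    by rewrite ler_wpM2l ?powR_ge0// expR_ge1Dx.
  rewrite /powR !gt_eqF// -expRD ler_expR.
  move: (ler_wpM2l (ltW e0) lnb).
  by move: (ln n.+2%:R) (ln n.+1%:R) (n.+2%:R^-1 : R) => x y z; lra.
by rewrite mulrDr mulr1 mulrCA -lerBrDl.
Qed.

Lemma series_powR_cvg (s : R) : 1 < s ->
  cvgn (series (fun n => n.+1%:R `^ (- s) : R)).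
Proof.
move=> s1; have e0 : 0 < s - 1 by rewrite subr_gt0.
apply: nondecreasing_is_cvgn.
  by apply: nondecreasing_series => n _ _; exact: powR_ge0.
exists (1 + (s - 1)^-1) => _ [n _ <-].
case: n => [|n]; first by rewrite /series/= big_nil addr_ge0// ltW// invr_gt0.
(* The bound telescopes [powR_telescope_ge], the first term being 1; keeping the subtracted power
   lets the induction close. *)
suff : series (fun n => n.+1%:R `^ (- s)) n.+1 <=
    1 + (s - 1)^-1 * (1 - n.+1%:R `^ (- (s - 1))).
  by move=> /le_trans; apply; rewrite lerD2l ler_piMr ?invr_ge0 ?(ltW e0)//.
elim: n => [|n ih].
  by rewrite /series/= big_nat1 !powR1 subrr mulr0 addr0.
rewrite seriesSr; apply: le_trans (lerD ih (lexx _)) _.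
rewrite -addrA lerD2l -lerBrDl -mulrBr ler_pdivlMl//.
have := powR_telescope_ge _ n e0; rewrite [1 + _]addrC subrK.
move=> /le_trans; apply.
by move: (n.+1%:R `^ _) (n.+2%:R `^ _) => x y; lra.
Qed.

Lemma series_powR_cvgP (s : R) :
  cvgn (series (fun n => n.+1%:R `^ (- s) : R)) <-> 1 < s.
Proof.
split=> [cs|]; last exact: series_powR_cvg.
(* For [s <= 1] each term dominates that of the divergent harmonic series. *)
rewrite ltNge; apply/negP => s1; apply: (@dvg_riemannR R 1).
  by rewrite ler01 lexx.
apply: series_le_cvg cs => n.
- by rewrite ltW// riemannR_gt0.
- exact: powR_ge0.
- by rewrite /riemannR -powRN ler_powR ?lerN2// ler1n.
Qed.

End dirichlet_bound.

(** * Power series dominated by the exponential series *)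

Lemma normcX (R : realType) (z : R[i]) n : normc (z ^+ n) = normc z ^+ n.
Proof. by elim: n => [|n ih]; rewrite ?expr0 ?normc1// !exprS normcM ih. Qed.

(** The terms are bounded by those of the series of exp (r |t|). *)
Lemma is_cvg_pseries_exp_bound (R : realType) (p : R^nat) (r t : R) :
  (forall n, `|p n| <= r ^+ n) -> cvgn (pseries (fun n => n`!%:R^-1 * p n) t).
Proof.
move=> pr; apply: normed_cvg.
have r0 n : 0 <= r ^+ n by exact: le_trans (pr n).
apply: series_le_cvg (is_cvg_series_exp_coeff (r * `|t|)) => n //=.
- by rewrite /exp_coeff /= exprMn !mulr_ge0 ?invr_ge0.
- rewrite /exp_coeff /= exprMn !normrM normrX.
  rewrite (@ger0_norm _ n`!%:R^-1) ?invr_ge0//.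
  by rewrite [leRHS]mulrC -mulrA ler_wpM2l ?invr_ge0// ler_wpM2r.
Qed.

Lemma lim_pseries0 (R : realType) (c : R^nat) : limn (pseries c 0) = c 0%N.
Proof.
(* The partial sum of index 0 is empty, hence the shift; all later ones equal [c 0], as 0^0 = 1. *)
apply: cvg_lim => //; rewrite -cvg_shiftS; apply: cvg_near_cst; near=> n.
rewrite /pseries /series /= big_nat_recl// expr0 mulr1 big1_seq ?addr0// => i _.
by rewrite expr0n mulr0.
Unshelve. all: by end_near. Qed.

(** * The complex exponential e^(t z), for real t, in real coordinates *)

Section complex_exponential_series.
Variables (R : realType) (z : R[i]).
Let x := complex.Re z.
Let y := complex.Im z.

(** Taylor coefficients at 0 of the real part of e^(t z), as a function of real t; [Im_exp_coef] is
    the analogue for the imaginary part. *)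
Definition Re_exp_coef n : R := n`!%:R^-1 * complex.Re (z ^+ n).
Definition Im_exp_coef n : R := n`!%:R^-1 * complex.Im (z ^+ n).

Lemma is_cvg_pseries_Re_exp t : cvgn (pseries Re_exp_coef t).
Proof.
apply: (@is_cvg_pseries_exp_bound _ _ (normc z)) => n.
by rewrite -normcX normr_Re_le.
Qed.

Lemma is_cvg_pseries_Im_exp t : cvgn (pseries Im_exp_coef t).
Proof.
apply: (@is_cvg_pseries_exp_bound _ _ (normc z)) => n.
by rewrite -normcX normr_Im_le.
Qed.

(** Coefficient form of f' = x f - y g, read off from z^(n+1) = z z^n. *)
Lemma Re_exp_coefS n :
  n.+1%:R * Re_exp_coef n.+1 = x * Re_exp_coef n - y * Im_exp_coef n.
Proof.
rewrite /Re_exp_coef /Im_exp_coef factS natrM invfM !mulrA mulfV ?mul1r//.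
by rewrite exprS /x /y; case: (z) (z ^+ n) => a b [c d] /=; ring.
Qed.

Lemma Im_exp_coefS n :
  n.+1%:R * Im_exp_coef n.+1 = y * Re_exp_coef n + x * Im_exp_coef n.
Proof.
rewrite /Re_exp_coef /Im_exp_coef factS natrM invfM !mulrA mulfV ?mul1r//.
by rewrite exprS /x /y; case: (z) (z ^+ n) => a b [c d] /=; ring.
Qed.

(** Formal differentiation preserves the span of the two coefficient sequences, so one lemma gives
    the convergence of all formal derivatives. *)
Lemma pseries_diffs_lincomb (a b : R) :
  pseries_diffs (fun n => a * Re_exp_coef n + b * Im_exp_coef n) =
  fun n => (a * x + b * y) * Re_exp_coef n + (b * x - a * y) * Im_exp_coef n.
Proof.
apply/funext => n; rewrite /pseries_diffs mulrDr (mulrCA _ a) (mulrCA _ b).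
by rewrite Re_exp_coefS Im_exp_coefS; ring.
Qed.

Lemma pseries_lincomb (a b t : R) :
  pseries (fun n => a * Re_exp_coef n + b * Im_exp_coef n) t =
  a *: pseries Re_exp_coef t + b *: pseries Im_exp_coef t.
Proof.
rewrite /pseries -!seriesZ -seriesD; congr series; apply/funext => n.
by rewrite [LHS]mulrDl -(mulrA a) -(mulrA b).
Qed.

Lemma pseries_lincomb_cvg (a b t : R) :
  pseries (fun n => a * Re_exp_coef n + b * Im_exp_coef n) t @ \oo -->
  a * limn (pseries Re_exp_coef t) + b * limn (pseries Im_exp_coef t).
Proof.
rewrite pseries_lincomb; apply: cvgD; apply: cvgMl_tmp.
- exact: is_cvg_pseries_Re_exp.
- exact: is_cvg_pseries_Im_exp.
Qed.

Definition Re_exp t := limn (pseries Re_exp_coef t).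
Definition Im_exp t := limn (pseries Im_exp_coef t).

Lemma is_derive_lincomb (a b t : R) :
  is_derive t (1 : R) (fun t => a * Re_exp t + b * Im_exp t)
    ((a * x + b * y) * Re_exp t + (b * x - a * y) * Im_exp t).
Proof.
have limE c d u :
    limn (pseries (fun n => c * Re_exp_coef n + d * Im_exp_coef n) u)
    = c * Re_exp u + d * Im_exp u.
  by apply: cvg_lim => //; exact: pseries_lincomb_cvg.
rewrite -limE -pseries_diffs_lincomb; under eq_fun do rewrite -limE.
(* Termwise differentiation at [t] asks for convergence of the series and of its first two formal
   derivatives at a point of larger absolute value. *)
apply: (@pseries_snd_diffs _ _ (`|t| + 1)); rewrite ?pseries_diffs_lincomb;
  try exact: cvgP (pseries_lincomb_cvg _ _ _).
by rewrite [ltRHS]ger0_norm ?addr_ge0// ltrDl.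
Qed.

Lemma is_derive_Re_exp (t : R) :
  is_derive t (1 : R) Re_exp (x * Re_exp t - y * Im_exp t).
Proof.
have := is_derive_lincomb 1 0 t; rewrite !mul1r !mul0r addr0 sub0r mulNr.
by under eq_fun do rewrite mul1r mul0r addr0.
Qed.

Lemma is_derive_Im_exp (t : R) :
  is_derive t (1 : R) Im_exp (y * Re_exp t + x * Im_exp t).
Proof.
have := is_derive_lincomb 0 1 t; rewrite !mul1r !mul0r add0r subr0.
by under eq_fun do rewrite mul1r mul0r add0r.
Qed.

Lemma sqr_norm_exp (t : R) :
  Re_exp t ^+ 2 + Im_exp t ^+ 2 = expR (t * x) ^+ 2.
Proof.
pose h t : R := (Re_exp t ^+ 2 + Im_exp t ^+ 2) * (expR (- x * t)) ^+ 2.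
have hcst : h t = h 0.
  apply: is_derive_0_is_cst => {}t; rewrite /h.
  have df := is_derive_Re_exp t; have dg := is_derive_Im_exp t.
  apply: trigger_derive.
  by rewrite /GRing.scale /=; ring.
have h0 : h 0 = 1.
  rewrite /h /Re_exp /Im_exp !lim_pseries0 mulr0 expR0.
  rewrite /Re_exp_coef /Im_exp_coef.
  by rewrite expr0 fact0 invr1 /=; ring.
move: hcst; rewrite h0 /h mulNr (mulrC x) expRN.
move=> /(congr1 ( *%R^~ (expR (t * x) ^+ 2))).
by rewrite mul1r exprVn mulfVK// expf_neq0// gt_eqF// expR_gt0.
Qed.

End complex_exponential_series.

(** * Modulus of the bicomplex exponential and of the zeta terms; continuity of i_R *)

Section bicomplex_exponential.
Variable R : realType.
Local Notation B := (bicomplex R).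
Implicit Types (w : B) (P : B -> R[i]).

(** Stated for an abstract unital algebra map [P], to serve both idempotent projections. *)
Lemma proj_series_exp P (w : B) (t : R) :
  P 1 = 1 -> {morph P : u v / u + v} -> {morph P : u v / u * v} ->
  (forall (a : R) u,
    P (a *: u) = Complex (a * complex.Re (P u)) (a * complex.Im (P u))) ->
  (forall n, complex.Re (P (series (fun n => n`!%:R^-1 *: (t *: w) ^+ n) n))
    = pseries (Re_exp_coef _ (P w)) t n) /\
  (forall n, complex.Im (P (series (fun n => n`!%:R^-1 *: (t *: w) ^+ n) n))
    = pseries (Im_exp_coef _ (P w)) t n).
Proof.
move=> P1 PD PM PZ.
have P0 : P 0 = Complex 0 0 by rewrite -(scale0r 0) PZ !mul0r.
have PX n : P (w ^+ n) = P w ^+ n.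
  by elim: n => [|n ih]; rewrite ?expr0// !exprS PM ih.
have PS n : P (series (fun n => n`!%:R^-1 *: (t *: w) ^+ n) n)
    = Complex (pseries (Re_exp_coef _ (P w)) t n)
              (pseries (Im_exp_coef _ (P w)) t n).
  elim: n => [|n ih]; first by rewrite /pseries /series /= !big_nil P0.
  rewrite /pseries !seriesSr PD ih exprZn !PZ PX /=.
  apply/eqP; rewrite eq_complex /= /Re_exp_coef /Im_exp_coef.
  by apply/andP; split; apply/eqP; rewrite /pseries; ring.
by split=> n; rewrite PS.
Qed.

Lemma bc_P1_1 : bc_P1 1 = 1 :> R[i].
Proof. by apply/eqP; rewrite eq_complex /= addr0 subr0 !eqxx. Qed.

Lemma bc_P2_1 : bc_P2 1 = 1 :> R[i].
Proof. by apply/eqP; rewrite eq_complex /= addr0 subr0 !eqxx. Qed.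

Lemma bc_P1Z (a : R) w :
  bc_P1 (a *: w) =
  Complex (a * complex.Re (bc_P1 w)) (a * complex.Im (bc_P1 w)).
Proof. by apply/eqP; rewrite eq_complex /= !mulrDr !mulrN !eqxx. Qed.

Lemma bc_P2Z (a : R) w :
  bc_P2 (a *: w) =
  Complex (a * complex.Re (bc_P2 w)) (a * complex.Im (bc_P2 w)).
Proof. by apply/eqP; rewrite eq_complex /= !mulrDr !mulrN !eqxx. Qed.

Lemma bc_expE w (t : R) : bc_exp (t *: w) =
  bc_of_proj _ (Complex (Re_exp _ (bc_P1 w) t) (Im_exp _ (bc_P1 w) t))
               (Complex (Re_exp _ (bc_P2 w) t) (Im_exp _ (bc_P2 w) t)).
Proof.
have [h1 h2] := proj_series_exp _ w t bc_P1_1 (@bc_P1D R) (@bc_P1M R) bc_P1Z.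
have [h3 h4] := proj_series_exp _ w t bc_P2_1 (@bc_P2D R) (@bc_P2M R) bc_P2Z.
apply: cvg_lim => //; apply: bc_cvg; rewrite ?bc_P1_of_proj ?bc_P2_of_proj.
- by under eq_fun do rewrite h1; exact: is_cvg_pseries_Re_exp.
- by under eq_fun do rewrite h2; exact: is_cvg_pseries_Im_exp.
- by under eq_fun do rewrite h3; exact: is_cvg_pseries_Re_exp.
- by under eq_fun do rewrite h4; exact: is_cvg_pseries_Im_exp.
Qed.

Lemma normc_exp (z : R[i]) (t : R) :
  normc (Complex (Re_exp _ z t) (Im_exp _ z t)) = expR (t * complex.Re z).
Proof. by rewrite /normc sqr_norm_exp sqrtr_sqr ger0_norm ?expR_ge0. Qed.

Lemma normc_P1_exp w (t : R) :
  normc (bc_P1 (bc_exp (t *: w))) = expR (t * complex.Re (bc_P1 w)).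
Proof. by rewrite bc_expE bc_P1_of_proj normc_exp. Qed.

Lemma normc_P2_exp w (t : R) :
  normc (bc_P2 (bc_exp (t *: w))) = expR (t * complex.Re (bc_P2 w)).
Proof. by rewrite bc_expE bc_P2_of_proj normc_exp. Qed.

(** Both components have positive modulus. This makes the division in [bc_zeta_term] a true
    inverse. *)
Lemma bc_exp_unit w (t : R) : bc_exp (t *: w) \is a GRing.unit.
Proof.
apply/andP; split; apply/eqP => h.
- have := normc_P1_exp w t; rewrite h normc0 => /esym/eqP.
  by rewrite gt_eqF ?expR_gt0.
- have := normc_P2_exp w t; rewrite h normc0 => /esym/eqP.
  by rewrite gt_eqF ?expR_gt0.
Qed.

Lemma norm_bc_zeta_term w n : `|bc_zeta_term w n| = n.+1%:R `^ (- bc_iR w).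
Proof.
rewrite /bc_zeta_term /bc_npow div1r.
set e := bc_exp _; have eu : e \is a GRing.unit by exact: bc_exp_unit.
have n1 : 1 <= n.+1%:R :> R by rewrite ler1n.
(* Multiplicativity of [bc_P1] makes the moduli of the components of [e] and [e^-1] inverse to each
   other. *)
have inv1 : normc (bc_P1 e^-1) = n.+1%:R `^ (- complex.Re (bc_P1 w)).
  have := congr1 (@normc R) (bc_P1M e e^-1).
  rewrite mulrV// bc_P1_1 normc1 normcM normc_P1_exp.
  rewrite powRN /powR gt_eqF ?ltr0n// (mulrC (ln _)) => /esym h.
  exact/esym/(mulr1_eq h).
have inv2 : normc (bc_P2 e^-1) = n.+1%:R `^ (- complex.Re (bc_P2 w)).
  have := congr1 (@normc R) (bc_P2M e e^-1).
  rewrite mulrV// bc_P2_1 normc1 normcM normc_P2_exp.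
  rewrite powRN /powR gt_eqF ?ltr0n// (mulrC (ln _)) => /esym h.
  exact/esym/(mulr1_eq h).
rewrite bc_normE inv1 inv2 /bc_iR.
(* As the base is at least 1, the larger of the two powers belongs to the smaller real part. *)
case: (leP (complex.Re (bc_P1 w)) (complex.Re (bc_P2 w))) => h.
- by rewrite max_l// ler_powR// lerN2.
- by rewrite max_r// ler_powR// lerN2 ltW.
Qed.

(** Each real part is 1-Lipschitz for the norm, and so is their minimum. Exchanging [u] and [v]
    gives the other inequality. *)
Lemma bc_iR_lipschitz (u v : B) : bc_iR u - `|u - v| <= bc_iR v.
Proof.
rewrite /bc_iR le_min; apply/andP; split.
- rewrite lerBlDl -lerBlDr; apply: le_trans (normc_P1_le _ _).
  apply: le_trans (le_trans (ler_norm _) (normr_Re_le _ _)); rewrite bc_P1B.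
  by rewrite complex_ReB lerB// ge_min lexx.
- rewrite lerBlDl -lerBlDr; apply: le_trans (normc_P2_le _ _).
  apply: le_trans (le_trans (ler_norm _) (normr_Re_le _ _)); rewrite bc_P2B.
  by rewrite complex_ReB lerB// ge_min lexx orbT.
Qed.

Lemma bc_iR_continuous : continuous (@bc_iR R).
Proof.
move=> w; suff : bc_iR u @[u --> w] --> bc_iR w by [].
apply/(@cvgrPdist_lt _ _ _ _ (nbhs_filter (w : B))) => e e0.
apply/nbhs_ballP; exists e => //= u; rewrite -ball_normE /ball_ /= => uw.
apply: le_lt_trans uw; rewrite ler_norml.
have := bc_iR_lipschitz w u; have := bc_iR_lipschitz u w; rewrite distrC.
by move: (`|w - u|) (bc_iR w) (bc_iR u) => a b c h1 h2; apply/andP; split; lra.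
Qed.

End bicomplex_exponential.

(** * Absolute convergence, bound by zeta, uniform convergence on compact sets *)

Theorem theorem5p2 (R : realType) :
  [/\ forall w : bicomplex R,
        cvgn (series (fun n => `|bc_zeta_term w n|)) <-> bc_U w,
      forall w : bicomplex R, bc_U w ->
        cvgn (series (bc_zeta_term w)) /\
        `|bc_zeta w| <= riemann_zeta (bc_iR w)
    & forall K : set (bicomplex R), compact K -> K `<=` @bc_U R ->
        {uniform K, (fun n w => series (bc_zeta_term w) n) @ \oo
                      --> (@bc_zeta R)}].
Proof.
have normE (w : bicomplex R) : (fun n => `|bc_zeta_term w n|)
    = (fun n => n.+1%:R `^ (- bc_iR w)).
  by apply/funext => n; exact: norm_bc_zeta_term.
have abscvg (w : bicomplex R) :
    cvgn (series (fun n => `|bc_zeta_term w n|)) <-> bc_U w.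
  by rewrite normE; exact: series_powR_cvgP.
split=> [//|w /abscvg cw|K cK KU].
  split; first exact: normed_cvg.
  by rewrite /riemann_zeta -normE; exact: lim_series_norm.
(* The empty set has no minimiser of [bc_iR]; any convergent majorant works there, such as the
   series of n^(-2). *)
have [->|K0] := eqVneq K set0.
  apply: (@weierstrass_M_test _ _ _ _ _ (fun n => n.+1%:R `^ (- 2))).
  - by move=> w n [].
  - by apply: series_powR_cvg; rewrite ltr1n.
(* [c] minimises [bc_iR] on [K]; as it lies in [bc_U], the exponent [bc_iR c] exceeds 1. *)
have [|c /set_mem Kc cmin] := compact_EVT_min _ cK
    (continuous_subspaceT (@bc_iR_continuous R)).
  exact/set0P.
apply: (@weierstrass_M_test _ _ _ _ _ (fun n => n.+1%:R `^ (- bc_iR c))).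
- move=> w n Kw; rewrite norm_bc_zeta_term ler_powR ?ler1n// lerN2.
  exact/cmin/mem_set.
- by apply: series_powR_cvg; exact: KU.
Qed.
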